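(* Let $(V,E)$ be a multigraph with no isolated vertex and let $\beta:L^2(E)\to L^2(E)\otimes\mathcal{A}$ be a bi-unitary co-representation of a compact quantum group $(\mathcal{A},\Delta)$ such that (a) $Ad_\beta(S(C(V^s)))\subseteq S(C(V^s))\otimes\mathcal{A}$, and (b) $Ad_{\overline\beta}(T(C(V^t)))\subseteq T(C(V^t))\otimes\mathcal{A}$. Furthermore assume that the induced co-actions $\alpha_s$ on $C(V^s)$ and $\alpha_t$ on $C(V^t)$ both preserve $C(V^s\cap V^t)$, that is, $\alpha_s(C(V^s\cap V^t))\subseteq C(V^s\cap V^t)\otimes\mathcal{A}\subseteq C(V^s)\otimes\mathcal{A}$ and $\alpha_t(C(V^s\cap V^t))\subseteq C(V^s\cap V^t)\otimes\mathcal{A}\subseteq C(V^t)\otimes\mathcal{A}$. Then the following conditions are equivalent: (1) $\alpha_s|_{C(V^s\cap V^t)}=\alpha_t|_{C(V^s\cap V^t)}$. (2) For all $j\in V^s\cap V^t$ and $\tau\in E$, $\beta(\chi_\tau)\alpha_s(\chi_j)=\beta(\chi_\tau.\chi_j)$. (3) For all $i\in V^s\cap V^t$ and $\tau\in E$, $\alpha_t(\chi_i)\beta(\chi_\tau)=\beta(\chi_i.\chi_\tau)$.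
   Context: A multigraph $(V,E)$ consists of finite sets $V$ (vertices), $E$ (edges) and source and target maps $s,t:E\to V$. No isolated vertex: every vertex is the source or target of some edge. $E^v=\{\tau\in E:s(\tau)=v\}$, $E_w=\{\tau\in E:t(\tau)=w\}$, $V^s=s(E)$, $V^t=t(E)$. For a finite set $X$, $C(X)$ is the algebra of complex functions on $X$ with basis the characteristic functions $\chi_x$, and $L^2(X)$ is the same space as a Hilbert space with orthonormal basis $(\chi_x)$. For $Y\subseteq X$, $C(Y)\subseteq C(X)$ is the span of $\{\chi_y:y\in Y\}$. $L^2(E)$ is a $C(V)$-$C(V)$ bimodule by $\chi_i.\chi_\tau=\delta_{i,s(\tau)}\chi_\tau$, $\chi_\tau.\chi_j=\delta_{t(\tau),j}\chi_\tau$ ($i,j\in V$), extended by $(f\otimes a)(\xi\otimes b)=f.\xi\otimes ab$ and $(\xi\otimes b)(f\otimes a)=\xi.f\otimes ba$ for $a,b\in\mathcal{A}$. $p_\tau\in B(L^2(E))$ is the projection onto $\mathbb{C}\chi_\tau$; $S:C(V^s)\to B(L^2(E))$, $S(\chi_v)=\sum_{\tau\in E^v}p_\tau$; $T:C(V^t)\to B(L^2(E))$, $T(\chi_w)=\sum_{\tau\in E_w}p_\tau$. Compact quantum groups are in Woronowicz's sense; C*-algebras are unital, tensor products minimal. A co-representation of $(\mathcal{A},\Delta)$ on $L^2(E)$ is a linear map $\beta$ with $\beta(\chi_\tau)=\sum_\sigma\chi_\sigma\otimes u^\sigma_\tau$ and $\Delta(u^\sigma_\tau)=\sum_\kappa u^\sigma_\kappa\otimes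 u^\kappa_\tau$; $U=(u^\sigma_\tau)$ is its co-representation matrix. It is unitary if $U$ is unitary; the contragradient $\overline\beta$ has matrix $(u^{\sigma*}_\tau)$; $\beta$ is bi-unitary if both are unitary. For a unitary co-representation with matrix $U$, $Ad(X)=U(X\otimes1)U^*$, $X\in B(L^2(E))$. A co-action on a unital C*-algebra $\mathcal{B}$ is a unital $*$-homomorphism $\alpha:\mathcal{B}\to\mathcal{B}\otimes\mathcal{A}$ with $(\alpha\otimes id)\alpha=(id\otimes\Delta)\alpha$ and $\mathrm{span}\,\alpha(\mathcal{B})(1\otimes\mathcal{A})$ norm-dense. Induced co-actions: under (a), $\alpha_s$ is the unique co-action of $(\mathcal{A},\Delta)$ on $C(V^s)$ with $\alpha_s(\chi_i)\beta(\chi_\tau)=\beta(\chi_i.\chi_\tau)$ for all $i\in V^s,\tau\in E$ (it exists); under (b), $\alpha_t$ is the unique co-action on $C(V^t)$ with $\beta(\chi_\tau)\alpha_t(\chi_j)=\beta(\chi_\tau.\chi_j)$ for all $j\in V^t,\tau\in E$ (it exists). *)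

(* Defs.v *)
From HB Require Import structures.
From mathcomp Require Import all_boot all_order all_algebra.
From mathcomp Require Import all_classical all_reals.
From mathcomp Require Import complex.
Set Implicit Arguments.
Unset Strict Implicit.
Unset Printing Implicit Defensive.

Import Order.TTheory GRing.Theory Num.Theory.

Local Open Scope classical_set_scope.
Local Open Scope ring_scope.
Local Open Scope complex_scope.

(* Unital C*-algebras over the complex numbers R[i].  An algType is a nonzero
   ring, so the zero algebra is excluded. *)
HB.mixin Record Algebra_isCStar (R : realType) A of GRing.Algebra R[i] A := {
  star : A -> A;
  starK : involutive star;
  starD : {morph star : x y / x + y};
  starZ : forall (a : R[i]) (x : A), star (a *: x) = a^* *: star x;
  starM : forall x y : A, star (x * y) = star y * star x;
  cnorm : A -> R;
  cnorm_eq0 : forall x : A, cnorm x = 0 -> x = 0;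
  cnormD : forall x y : A, cnorm (x + y) <= cnorm x + cnorm y;
  cnormZ : forall (a : R[i]) (x : A),
    (cnorm (a *: x))%:C = `|a| * (cnorm x)%:C;
  cnormM : forall x y : A, cnorm (x * y) <= cnorm x * cnorm y;
  cnorm_starM : forall x : A, cnorm (star x * x) = cnorm x ^+ 2;
  cnorm_complete : forall u : nat -> A,
    (forall eps : R, 0 < eps -> exists N : nat, forall m n : nat,
       (N <= m)%N -> (N <= n)%N -> cnorm (u m - u n) < eps) ->
    exists l : A, forall eps : R, 0 < eps -> exists N : nat, forall n : nat,
       (N <= n)%N -> cnorm (u n - l) < eps
}.

#[short(type="cstarAlgType")]
HB.structure Definition CStarAlgebra (R : realType) :=
  {A of GRing.Algebra R[i] A & Algebra_isCStar R A}.

Section CStar.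
Variable R : realType.
Implicit Types A B D T : cstarAlgType R.

Definition norm_dense A (P : set A) : Prop :=
  forall (x : A) (eps : R), 0 < eps -> exists2 y : A, P y & cnorm (x - y) < eps.

Record unital_star_hom A B (f : A -> B) : Prop := {
  ush_linear : forall (a : R[i]) (x y : A), f (a *: x + y) = a *: f x + f y;
  ush_one : f 1 = 1;
  ush_mul : forall x y : A, f (x * y) = f x * f y;
  ush_star : forall x : A, f (star x) = star (f x)
}.

(* T, with the elementary tensors [tens a b], is a C*-algebra completion of
   the algebraic tensor product of A and B. *)
Record is_cstar_tensor A B T (tens : A -> B -> T) : Prop := {
  tens_linearl : forall (c : R[i]) (a a' : A) (b : B),
    tens (c *: a + a') b = c *: tens a b + tens a' b;
  tens_linearr : forall (c : R[i]) (a : A) (b b' : B),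
    tens a (c *: b + b') = c *: tens a b + tens a b';
  tens_one : tens 1 1 = 1;
  tens_mul : forall (a a' : A) (b b' : B),
    tens a b * tens a' b' = tens (a * a') (b * b');
  tens_star : forall (a : A) (b : B), star (tens a b) = tens (star a) (star b);
  (* the algebraic tensor product embeds into T *)
  tens_inj : forall (n : nat) (a : 'I_n -> A) (b : 'I_n -> B),
    (forall c : 'I_n -> R[i],
       \sum_(k < n) c k *: a k = 0 -> forall k, c k = 0) ->
    \sum_(k < n) tens (a k) (b k) = 0 -> forall k, b k = 0;
  tens_dense : norm_dense [set x : T | exists (n : nat) (a : 'I_n -> A)
    (b : 'I_n -> B), x = \sum_(k < n) tens (a k) (b k)]
}.

(* The minimal tensor product is the completion for the least C*-norm on the
   algebraic tensor product; it is unique up to isomorphism. *)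
Record is_min_tensor A B T (tens : A -> B -> T) : Prop := {
  min_tensor_cstar : is_cstar_tensor tens;
  min_tensor_le : forall (D : cstarAlgType R) (tens' : A -> B -> D),
    is_cstar_tensor tens' ->
    forall (n : nat) (a : 'I_n -> A) (b : 'I_n -> B),
      cnorm (\sum_(k < n) tens (a k) (b k)) <=
      cnorm (\sum_(k < n) tens' (a k) (b k))
}.

(* Compact quantum groups (A, Delta) in the sense of Woronowicz, together with
   models of A (x) A and of A (x) A (x) A; the latter is at the same time
   (A (x) A) (x) A, via cqg_tensl, and A (x) (A (x) A), via cqg_tensr. *)
Record cqg := CQG {
  cqg_alg : cstarAlgType R;
  cqg_alg2 : cstarAlgType R;
  cqg_alg3 : cstarAlgType R;
  cqg_tens : cqg_alg -> cqg_alg -> cqg_alg2;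
  cqg_tensl : cqg_alg2 -> cqg_alg -> cqg_alg3;
  cqg_tensr : cqg_alg -> cqg_alg2 -> cqg_alg3;
  cqg_tensP : is_min_tensor cqg_tens;
  cqg_tenslP : is_min_tensor cqg_tensl;
  cqg_tensrP : is_min_tensor cqg_tensr;
  cqg_tensA : forall a b c : cqg_alg,
    cqg_tensl (cqg_tens a b) c = cqg_tensr a (cqg_tens b c);
  cqg_delta : cqg_alg -> cqg_alg2;
  cqg_delta_hom : unital_star_hom cqg_delta;
  (* coassociativity; dI and Id are Delta (x) id and id (x) Delta *)
  cqg_coassoc : exists dI Id : cqg_alg2 -> cqg_alg3,
    [/\ unital_star_hom dI, unital_star_hom Id,
        forall a b, dI (cqg_tens a b) = cqg_tensl (cqg_delta a) b,
        forall a b, Id (cqg_tens a b) = cqg_tensr a (cqg_delta b)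
      & forall a, dI (cqg_delta a) = Id (cqg_delta a)];
  cqg_densel : norm_dense [set x : cqg_alg2 | exists (n : nat)
      (a b : 'I_n -> cqg_alg),
      x = \sum_(k < n) cqg_delta (a k) * cqg_tens (b k) 1];
  cqg_denser : norm_dense [set x : cqg_alg2 | exists (n : nat)
      (a b : 'I_n -> cqg_alg),
      x = \sum_(k < n) cqg_delta (a k) * cqg_tens 1 (b k)]
}.

End CStar.

(* For finite X, {ffun X -> R[i]} is C(X) (and L^2(X)), and {ffun X -> A} is
   its tensor product with A. *)
Section FiniteTensor.
Variables (R : realType) (A : cstarAlgType R) (X : finType).

Definition chi (x : X) : {ffun X -> R[i]} := [ffun y => (y == x)%:R].

Definition ftens (f : {ffun X -> R[i]}) (a : A) : {ffun X -> A} :=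
  [ffun x => f x *: a].

(* P (x) A, for a linear subspace P of C(X) *)
Definition sub_tens (P : set {ffun X -> R[i]}) : set {ffun X -> A} :=
  [set F | exists (n : nat) (f : 'I_n -> {ffun X -> R[i]}) (a : 'I_n -> A),
     (forall k, P (f k)) /\ F = \sum_(k < n) ftens (f k) (a k)].

(* C(Y), for Y a subset of X *)
Definition Cfun (Y : {set X}) : set {ffun X -> R[i]} :=
  [set f | exists c : X -> R[i], f = \sum_(y in Y) c y *: chi y].

Definition fmul (F G : {ffun X -> A}) : {ffun X -> A} :=
  [ffun x => F x * G x].

Definition fstar (F : {ffun X -> A}) : {ffun X -> A} :=
  [ffun x => star (F x)].

End FiniteTensor.

Section Coaction.
Variables (R : realType) (G : cqg R) (X : finType).
Let A := cqg_alg G.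

(* Co-actions of G on the C*-algebra C(Y), whose unit is the characteristic
   function of Y.  The values of alpha outside C(Y) are irrelevant. *)
Record is_coaction (Y : {set X}) (alpha : {ffun X -> R[i]} -> {ffun X -> A}) :
    Prop := {
  coact_sub : forall f, Cfun Y f -> sub_tens (Cfun Y) (alpha f);
  coact_linear : forall (c : R[i]) (f g : {ffun X -> R[i]}),
    Cfun Y f -> Cfun Y g -> alpha (c *: f + g) = c *: alpha f + alpha g;
  coact_one : alpha (\sum_(y in Y) chi R y) =
    ftens (\sum_(y in Y) chi R y) 1;
  coact_mul : forall f g : {ffun X -> R[i]}, Cfun Y f -> Cfun Y g ->
    alpha [ffun x => f x * g x] = fmul (alpha f) (alpha g);
  coact_star : forall f : {ffun X -> R[i]}, Cfun Y f ->
    alpha [ffun x => (f x)^*] = fstar (alpha f);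
  (* (alpha (x) id) alpha = (id (x) Delta) alpha, where for F in C(Y) (x) A,
     F = \sum_(y in Y) chi_y (x) F y *)
  coact_coassoc : forall (f : {ffun X -> R[i]}) (x : X), Cfun Y f ->
    \sum_(y in Y) cqg_tens (alpha (chi R y) x) (alpha f y) =
    cqg_delta (alpha f x);
  (* span alpha(C(Y)) (1 (x) A) is dense in C(Y) (x) A for the sup norm *)
  coact_dense : forall (F : {ffun X -> A}) (eps : R),
    sub_tens (Cfun Y) F -> 0 < eps ->
    exists (n : nat) (f : 'I_n -> {ffun X -> R[i]}) (a : 'I_n -> A),
      (forall k, Cfun Y (f k)) /\
      forall x, cnorm (F x - \sum_(k < n) alpha (f k) x * a k) < eps
}.

End Coaction.

(* The algebras B(L^2(E)) = {ffun E * E -> R[i]} and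
   B(L^2(E)) (x) A = {ffun E * E -> A} of matrices; the entry at
   (sigma, tau) is the coefficient of chi_sigma in the image of chi_tau. *)
Section Matrices.
Variables (R : realType) (A : cstarAlgType R) (E : finType).

Definition emx_one : {ffun E * E -> A} := [ffun p => (p.1 == p.2)%:R].

Definition emx_mul (M N : {ffun E * E -> A}) : {ffun E * E -> A} :=
  [ffun p => \sum_(k : E) M (p.1, k) * N (k, p.2)].

Definition emx_adj (M : {ffun E * E -> A}) : {ffun E * E -> A} :=
  [ffun p => star (M (p.2, p.1))].

Definition emx_unitary (M : {ffun E * E -> A}) : Prop :=
  emx_mul M (emx_adj M) = emx_one /\ emx_mul (emx_adj M) M = emx_one.

Definition emx_Ad (U : {ffun E * E -> A}) (X : {ffun E * E -> R[i]}) :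
    {ffun E * E -> A} :=
  emx_mul (emx_mul U (ftens X 1)) (emx_adj U).

End Matrices.

Section Corepresentation.
Variables (R : realType) (G : cqg R) (E : finType).
Let A := cqg_alg G.
Variable beta : {linear {ffun E -> R[i]} -> {ffun E -> A}}.

Definition corep_mx : {ffun E * E -> A} :=
  [ffun p => beta (chi R p.2) p.1].

Definition is_corep : Prop := forall sigma tau : E,
  cqg_delta (corep_mx (sigma, tau)) =
  \sum_(kappa : E) cqg_tens (corep_mx (sigma, kappa)) (corep_mx (kappa, tau)).

(* the matrix of the contragradient of beta *)
Definition contra_mx : {ffun E * E -> A} := fstar corep_mx.

Definition bi_unitary_corep : Prop :=
  [/\ is_corep, emx_unitary corep_mx & emx_unitary contra_mx].

End Corepresentation.

Section Multigraph.
Variables (R : realType) (A : cstarAlgType R) (V E : finType) (s t : E -> V).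

Definition no_isolated_vertex : Prop :=
  forall v : V, exists tau : E, s tau = v \/ t tau = v.

Definition Vs : {set V} := [set s tau | tau : E].
Definition Vt : {set V} := [set t tau | tau : E].

(* the C(V)-C(V) bimodule structure of L^2(E) *)
Definition lact (f : {ffun V -> R[i]}) (xi : {ffun E -> R[i]}) :
    {ffun E -> R[i]} := [ffun tau => f (s tau) * xi tau].
Definition ract (xi : {ffun E -> R[i]}) (f : {ffun V -> R[i]}) :
    {ffun E -> R[i]} := [ffun tau => xi tau * f (t tau)].

(* the C(V) (x) A - C(V) (x) A bimodule structure of L^2(E) (x) A *)
Definition lactA (F : {ffun V -> A}) (Xi : {ffun E -> A}) : {ffun E -> A} :=
  [ffun tau => F (s tau) * Xi tau].
Definition ractA (Xi : {ffun E -> A}) (F : {ffun V -> A}) : {ffun E -> A} :=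
  [ffun tau => Xi tau * F (t tau)].

Lemma lact_chi (i : V) (tau : E) :
  lact (chi R i) (chi R tau) = (i == s tau)%:R *: chi R tau.
Proof.
apply/ffunP => sigma; rewrite !ffunE /= [i == _]eq_sym.
by case: (eqVneq sigma tau) => [->|_]; rewrite ?mulr0 ?scaler0.
Qed.

Lemma ract_chi (tau : E) (j : V) :
  ract (chi R tau) (chi R j) = (t tau == j)%:R *: chi R tau.
Proof.
apply/ffunP => sigma; rewrite !ffunE /=.
case: (eqVneq sigma tau) => [->|_]; rewrite ?mul0r ?scaler0 // mul1r.
by rewrite -[RHS]/(_ * _) mulr1.
Qed.

Lemma lactA_ftens (f : {ffun V -> R[i]}) (xi : {ffun E -> R[i]}) (a b : A) :
  lactA (ftens f a) (ftens xi b) = ftens (lact f xi) (a * b).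
Proof.
by apply/ffunP => tau; rewrite !ffunE -scalerAl -scalerAr scalerA.
Qed.

Lemma ractA_ftens (xi : {ffun E -> R[i]}) (f : {ffun V -> R[i]}) (b a : A) :
  ractA (ftens xi b) (ftens f a) = ftens (ract xi f) (b * a).
Proof.
by apply/ffunP => tau; rewrite !ffunE -scalerAl -scalerAr scalerA.
Qed.

(* the projection p_tau onto the line spanned by chi_tau *)
Definition edge_proj (tau : E) : {ffun E * E -> R[i]} := chi R (tau, tau).

Definition Smap (f : {ffun V -> R[i]}) : {ffun E * E -> R[i]} :=
  \sum_(v in Vs) f v *: \sum_(tau | s tau == v) edge_proj tau.
Definition Tmap (f : {ffun V -> R[i]}) : {ffun E * E -> R[i]} :=
  \sum_(w in Vt) f w *: \sum_(tau | t tau == w) edge_proj tau.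

End Multigraph.

Section InducedCoactions.
Variables (R : realType) (G : cqg R) (V E : finType) (s t : E -> V).
Let A := cqg_alg G.
Variable beta : {linear {ffun E -> R[i]} -> {ffun E -> A}}.

Definition source_condition : Prop :=
  forall f : {ffun V -> R[i]}, Cfun (Vs s) f ->
    sub_tens (Smap s @` Cfun (Vs s)) (emx_Ad (corep_mx beta) (Smap s f)).

Definition target_condition : Prop :=
  forall f : {ffun V -> R[i]}, Cfun (Vt t) f ->
    sub_tens (Tmap t @` Cfun (Vt t)) (emx_Ad (contra_mx beta) (Tmap t f)).

Definition induced_source (alpha : {ffun V -> R[i]} -> {ffun V -> A}) : Prop :=
  is_coaction (Vs s) alpha /\
  forall (i : V) (tau : E), i \in Vs s ->
    lactA s (alpha (chi R i)) (beta (chi R tau)) =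
    beta (lact s (chi R i) (chi R tau)).

Definition induced_target (alpha : {ffun V -> R[i]} -> {ffun V -> A}) : Prop :=
  is_coaction (Vt t) alpha /\
  forall (j : V) (tau : E), j \in Vt t ->
    ractA t (beta (chi R tau)) (alpha (chi R j)) =
    beta (ract t (chi R tau) (chi R j)).

Definition preserves (W : {set V})
    (alpha : {ffun V -> R[i]} -> {ffun V -> A}) : Prop :=
  forall f : {ffun V -> R[i]}, Cfun W f -> sub_tens (Cfun W) (alpha f).

End InducedCoactions.

(* Main.v *)
Require Import Defs.
From mathcomp Require Import all_boot all_order all_algebra.
From mathcomp Require Import all_classical all_reals complex.
Import GRing.Theory.
Local Open Scope classical_set_scope.
Local Open Scope ring_scope.
Local Open Scope complex_scope.
Set Implicit Arguments.
Unset Strict Implicit.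
Unset Printing Implicit Defensive.

(** Write u^sigma_tau for the entries of the matrix of beta.  The defining
    property of alpha_s reads
      alpha_s(chi_i)(s sigma) * u^sigma_tau = [i = s tau] u^sigma_tau,
    and that of alpha_t reads
      u^sigma_tau * alpha_t(chi_j)(t sigma) = [t tau = j] u^sigma_tau.
    Unitarity of the matrix, sum_tau u^sigma_tau (u^sigma_tau)^* = 1, means that
    the elements u^sigma_tau of row sigma can be cancelled jointly on the right;
    unitarity of its entrywise adjoint, sum_tau (u^sigma_tau)^* u^sigma_tau = 1,
    that they can be cancelled jointly on the left ([unitary_row_cancelr],
    [contra_unitary_row_cancell]).  Hence each of the two properties determines
    the values of a function V -> A at all sources, respectively at all targets,
    of edges.

    Condition (2) says that alpha_s(chi_j) satisfies the property that
    determines alpha_t(chi_j), so it forces equality on the set of targets;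
    outside this set both functions vanish, because each of them is supported
    in a subset of the targets (for alpha_s(chi_j) this is the assumption that
    alpha_s preserves the functions on the intersection).  Condition (3) is
    treated in the same way at the sources, and the passage from the chi_j to
    arbitrary functions on the intersection is linearity.  Conversely (1) turns
    the defining property of alpha_t into (2) and that of alpha_s into (3). *)

Section SupportedFunctions.
Variables (R : realType) (X : finType).
Implicit Types (Y W : {set X}) (f : {ffun X -> R[i]}).

Lemma Cfun_supportP Y f : Cfun Y f <-> (forall x, x \notin Y -> f x = 0).
Proof.
split=> [[c ->] x xY|f0].
  rewrite sum_ffunE big1 // => y yY; rewrite !ffunE.
  case: eqVneq => [exy|_]; last exact: mulr0.
  by rewrite exy yY in xY.
exists f; apply/ffunP => x; rewrite sum_ffunE.
have [xY|xY] := boolP (x \in Y); last first.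
  rewrite f0 // big1 // => y yY; rewrite !ffunE.
  case: eqVneq => [exy|_]; last by rewrite -[RHS](mulr0 (f y)).
  by rewrite exy yY in xY.
rewrite (bigD1 x) //= big1 ?addr0 => [|y /andP[_ nyx]]; rewrite !ffunE.
  by rewrite eqxx -[LHS]mulr1.
by rewrite eq_sym (negbTE nyx) -[RHS](mulr0 (f y)).
Qed.

Lemma Cfun_chi Y y : y \in Y -> Cfun Y (chi R y).
Proof.
move=> yY; apply/Cfun_supportP => x xY; rewrite ffunE.
by case: eqVneq => // exy; rewrite exy yY in xY.
Qed.

Lemma sub_tens_support (A : cstarAlgType R) Y (F : {ffun X -> A}) x :
  sub_tens (Cfun Y) F -> x \notin Y -> F x = 0.
Proof.
move=> [n [f [a [fY ->]]]] xY; rewrite sum_ffunE big1 // => k _.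
by rewrite ffunE (proj1 (Cfun_supportP _ _) (fY k)) // scale0r.
Qed.

End SupportedFunctions.

Section CoactionLinearity.
Variables (R : realType) (G : cqg R) (X : finType).

Lemma coaction_sum (Y W : {set X}) (alpha : {ffun X -> R[i]} -> _)
    (c : X -> R[i]) :
  is_coaction (G := G) Y alpha -> W \subset Y ->
  alpha (\sum_(y in W) c y *: chi R y) = \sum_(y in W) c y *: alpha (chi R y).
Proof.
move=> alphaP /fintype.subsetP sWY.
have Y0 : Cfun Y (0 : {ffun X -> R[i]}).
  by apply/Cfun_supportP => x _; rewrite ffunE.
have alpha0 : alpha 0 = 0.
  have := coact_linear alphaP 1 Y0 Y0.
  by rewrite !scale1r addr0 => /(congr1 (fun z => z - alpha 0)); rewrite addrK subrr.
(* [coact_linear] applies to elements of C(Y) only, so membership of the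
   partial sums is part of the induction. *)
suff [] : Cfun Y (\sum_(y in W) c y *: chi R y) /\
    alpha (\sum_(y in W) c y *: chi R y) =
    \sum_(y in W) c y *: alpha (chi R y) by [].
elim/big_rec2: _ => [//|y F f yW [Yf <-]].
have Yy := Cfun_chi R (sWY _ yW).
split; last exact: (coact_linear alphaP).
apply/Cfun_supportP => x xY; rewrite !ffunE.
have := proj1 (Cfun_supportP _ _) Yy x xY; rewrite ffunE => ->.
by rewrite (proj1 (Cfun_supportP _ _) Yf x xY) addr0 -[LHS]/(c y * 0) mulr0.
Qed.

Lemma coaction_eq_on_chi (Y Z W : {set X}) (alpha gamma : {ffun X -> R[i]} -> _) :
  is_coaction (G := G) Y alpha -> is_coaction (G := G) Z gamma ->
  W \subset Y -> W \subset Z ->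
  (forall y, y \in W -> alpha (chi R y) = gamma (chi R y)) ->
  forall f, Cfun W f -> alpha f = gamma f.
Proof.
move=> aP gP WY WZ eq_chi f [c ->].
rewrite (coaction_sum c aP WY) (coaction_sum c gP WZ).
by apply: eq_bigr => y yW; rewrite eq_chi.
Qed.

End CoactionLinearity.

Section RowCancellation.
Variables (R : realType) (A : cstarAlgType R) (E : finType).
Variables (M : {ffun E * E -> A}) (sigma : E).

(** Multiply by the adjoints of the row entries on the right and add up: the
    diagonal entry (sigma, sigma) of M M^* is 1. *)
Lemma unitary_row_cancelr (x y : A) : emx_unitary M ->
  (forall tau, x * M (sigma, tau) = y * M (sigma, tau)) -> x = y.
Proof.
move=> [/ffunP /(_ (sigma, sigma)) + _] eq_xy; rewrite !ffunE /= eqxx => row1.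
rewrite -[x]mulr1 -[y]mulr1 -[1]row1 !mulr_sumr.
by apply: eq_bigr => tau _; rewrite !mulrA eq_xy.
Qed.

(** The entries of the entrywise adjoint are the adjoints of the u^sigma_tau,
    so that the diagonal entries of its unitarity relation have the adjoints
    on the left. *)
Lemma contra_unitary_row_cancell (x y : A) : emx_unitary (fstar M) ->
  (forall tau, M (sigma, tau) * x = M (sigma, tau) * y) -> x = y.
Proof.
move=> [/ffunP /(_ (sigma, sigma)) + _] eq_xy; rewrite !ffunE /= eqxx => row1.
rewrite -[x]mul1r -[y]mul1r -[1]row1 !mulr_suml.
by apply: eq_bigr => tau _; rewrite !ffunE starK -!mulrA eq_xy.
Qed.

End RowCancellation.

Section Determination.
Variables (R : realType) (G : cqg R) (V E : finType) (s t : E -> V).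
Variable beta : {linear {ffun E -> R[i]} -> {ffun E -> cqg_alg G}}.
Implicit Types F H : {ffun V -> cqg_alg G}.

(** Uniqueness of the induced co-action on the sources, stated for single
    functions so that it also applies to values of the other co-action. *)
Lemma lactA_determines F H : emx_unitary (corep_mx beta) ->
  (forall tau, lactA s F (beta (chi R tau)) = lactA s H (beta (chi R tau))) ->
  forall v, v \in Vs s -> F v = H v.
Proof.
move=> uU eqFH _ /imsetP[sigma _ ->].
apply: (unitary_row_cancelr (sigma := sigma) uU) => tau.
by move/ffunP: (eqFH tau) => /(_ sigma); rewrite !ffunE.
Qed.

Lemma ractA_determines F H : emx_unitary (contra_mx beta) ->
  (forall tau, ractA t (beta (chi R tau)) F = ractA t (beta (chi R tau)) H) ->
  forall v, v \in Vt t -> F v = H v.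
Proof.
move=> uU eqFH _ /imsetP[sigma _ ->].
apply: (contra_unitary_row_cancell (sigma := sigma) uU) => tau.
by move/ffunP: (eqFH tau) => /(_ sigma); rewrite !ffunE.
Qed.

End Determination.

Theorem theorem3p6 (R : realType) (V E : finType) (s t : E -> V)
  (G : cqg R) (beta : {linear {ffun E -> R[i]} -> {ffun E -> cqg_alg G}})
  (alpha_s alpha_t : {ffun V -> R[i]} -> {ffun V -> cqg_alg G})
  (hV : no_isolated_vertex s t)
  (hbeta : bi_unitary_corep beta)
  (ha : source_condition s beta)
  (hb : target_condition t beta)
  (hs : induced_source s beta alpha_s)
  (ht : induced_target t beta alpha_t)
  (hps : preserves (Vs s :&: Vt t)%SET alpha_s)
  (hpt : preserves (Vs s :&: Vt t)%SET alpha_t) :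
  let cond1 := forall f : {ffun V -> R[i]},
    Cfun (Vs s :&: Vt t)%SET f -> alpha_s f = alpha_t f in
  let cond2 := forall (j : V) (tau : E), j \in (Vs s :&: Vt t)%SET ->
    ractA t (beta (chi R tau)) (alpha_s (chi R j)) =
    beta (ract t (chi R tau) (chi R j)) in
  let cond3 := forall (i : V) (tau : E), i \in (Vs s :&: Vt t)%SET ->
    lactA s (alpha_t (chi R i)) (beta (chi R tau)) =
    beta (lact s (chi R i) (chi R tau)) in
  (cond1 <-> cond2) /\ (cond2 <-> cond3).
Proof.
move=> cond1 cond2 cond3.
have [_ uU uUbar] := hbeta.
have [coact_s defs] := hs; have [coact_t deft] := ht.
have Ws : (Vs s :&: Vt t \subset Vs s)%SET := finset.subsetIl _ _.
have Wt : (Vs s :&: Vt t \subset Vt t)%SET := finset.subsetIr _ _.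
have eq_on_chi := coaction_eq_on_chi coact_s coact_t Ws Wt.
have supp_s j v : j \in (Vs s :&: Vt t)%SET -> v \notin (Vs s :&: Vt t)%SET ->
    alpha_s (chi R j) v = 0.
  by move=> jW; apply: sub_tens_support; apply/hps/Cfun_chi.
have supp_t j v : j \in (Vs s :&: Vt t)%SET -> v \notin (Vs s :&: Vt t)%SET ->
    alpha_t (chi R j) v = 0.
  by move=> jW; apply: sub_tens_support; apply/hpt/Cfun_chi.
have c12 : cond1 -> cond2.
  move=> c1 j tau jW; rewrite (c1 _ (Cfun_chi R jW)).
  exact/deft/(fintype.subsetP Wt).
have c13 : cond1 -> cond3.
  move=> c1 i tau iW; rewrite -(c1 _ (Cfun_chi R iW)).
  exact/defs/(fintype.subsetP Ws).
have c21 : cond2 -> cond1.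
  move=> c2; apply: eq_on_chi => j jW; apply/ffunP => v.
  have [vW|vW] := boolP (v \in (Vs s :&: Vt t)%SET); last first.
    by rewrite supp_s // supp_t.
  apply: (ractA_determines uUbar) (fintype.subsetP Wt _ vW) => tau.
  by rewrite c2 // deft // (fintype.subsetP Wt).
have c31 : cond3 -> cond1.
  move=> c3; apply: eq_on_chi => i iW; apply/ffunP => v.
  have [vW|vW] := boolP (v \in (Vs s :&: Vt t)%SET); last first.
    by rewrite supp_s // supp_t.
  apply: (lactA_determines uU) (fintype.subsetP Ws _ vW) => tau.
  by rewrite c3 // defs // (fintype.subsetP Ws).
by split; [split=> [/c12|/c21] | split=> [/c21/c13|/c31/c12]].
Qed.
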